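(* Let $f:[1,\infty)\to(0,\infty)$ be a function such that $[\log f(x)]''$ is completely monotonic on $[1,\infty)$. Let $a_n=f(n)$ for $n\geq 1$. Then the sequence $\{a_n\}_{n\geq 1}$ is infinitely log-monotonic.
   Context: A function $\phi$ is completely monotonic on an interval $I$ if it has derivatives of all orders on $I$ and $(-1)^n\phi^{(n)}(x)\ge 0$ for all $x\in I$ and all integers $n\ge 0$. For a sequence $(x_n)_{n\ge m}$ of positive reals: it is log-concave (resp. log-convex) if $x_n^2\ge x_{n-1}x_{n+1}$ (resp. $x_n^2\le x_{n-1}x_{n+1}$) for all $n\ge m+1$. The operator $\mathcal R$ sends $(x_n)_{n\ge m}$ to $(x_{n+1}/x_n)_{n\ge m}$. The sequence is log-monotonic of order $k$ if for every integer $r$ with $0\le r\le k-1$, $\mathcal R^r(x_n)$ is log-convex when $r$ is even and log-concave when $r$ is odd. It is infinitely log-monotonic if it is log-monotonic of order $k$ for every integer $k\ge 1$. *)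

(* Defs.v *)
From Stdlib Require Import Reals Arith.
Open Scope R_scope.

(* [D] is the domain, an interval with more than one point.  [D_in] takes the
   limit of the difference quotient within [D], so the derivative at an endpoint
   of [D] is one-sided and values outside [D] play no role. *)
Definition derivative_on (D : R -> Prop) (phi dphi : R -> R) : Prop :=
  forall x : R, D x -> D_in phi dphi D x.

Fixpoint nth_derivative_on (D : R -> Prop) (n : nat) (phi psi : R -> R) : Prop :=
  match n with
  | O => forall x : R, D x -> psi x = phi x
  | S p => exists d : R -> R,
      nth_derivative_on D p phi d /\ derivative_on D d psi
  end.

Definition completely_monotonic_on (D : R -> Prop) (phi : R -> R) : Prop :=
  (forall n : nat, exists psi : R -> R, nth_derivative_on D n phi psi) /\
  (forall (n : nat) (psi : R -> R), nth_derivative_on D n phi psi ->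
     forall x : R, D x -> 0 <= (-1) ^ n * psi x).

(* A sequence (x_n)_{n >= m} is a function [x : nat -> R] together with [m];
   the values of [x] below [m] are never used. *)
Definition log_concave (m : nat) (x : nat -> R) : Prop :=
  forall n : nat, (m + 1 <= n)%nat -> x (n - 1)%nat * x (n + 1)%nat <= x n ^ 2.

Definition log_convex (m : nat) (x : nat -> R) : Prop :=
  forall n : nat, (m + 1 <= n)%nat -> x n ^ 2 <= x (n - 1)%nat * x (n + 1)%nat.

Definition ratio_op (x : nat -> R) : nat -> R :=
  fun n => x (n + 1)%nat / x n.

Definition log_monotonic (m k : nat) (x : nat -> R) : Prop :=
  forall r : nat, (r < k)%nat ->
    (Nat.Even r -> log_convex m (Nat.iter r ratio_op x)) /\
    (Nat.Odd r -> log_concave m (Nat.iter r ratio_op x)).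

Definition infinitely_log_monotonic (m : nat) (x : nat -> R) : Prop :=
  forall k : nat, (1 <= k)%nat -> log_monotonic m k x.

(* Main.v *)
(** Write [h = ln f] and [drop u x = u x - u (x + 1)]. The [r]-th iterated ratio
    of [a_n = f n] is [exp ((-1)^r * (drop^r h) n)], so it suffices that every
    [drop^r h] is convex along the integers. Its second derivative is
    [drop^r phi], and [drop] preserves complete monotonicity, because
    [(-1)^n * phi^(n)] is nonincreasing. *)
Require Import Defs.
From Stdlib Require Import Reals Arith Lra Lia.
Open Scope R_scope.

Section Ray.
Variable a : R.
Let ray (x : R) : Prop := a <= x.

(* The mean value theorem wants two-sided continuity at the endpoints, hence the
   constant extension to the left of [a]. *)
Lemma continuity_pt_Rmax_extension (u du : R -> R) :
  derivative_on ray u du -> forall x, ray x ->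
  continuity_pt (fun y => u (Rmax a y)) x.
Proof.
intros Hu x Hx eps Heps.
destruct (cont_deriv _ _ _ _ (Hu x Hx) eps Heps) as [delta [Hdelta Hclose]].
exists delta; split; [exact Hdelta|].
intros y [_ Hy]; simpl in *; unfold Rdist in *.
rewrite (Rmax_right a x Hx).
(* The limit within the ray leaves out [x] itself, yet [Rmax a y] can hit it: when [x = a], every
   [y < a] is sent to [x]. *)
destruct (Req_dec x (Rmax a y)) as [<-|Hneq].
- rewrite Rminus_diag, Rabs_R0; exact Heps.
- apply Hclose; split.
  + split; [exact (Rmax_l a y)|exact Hneq].
  + eapply Rle_lt_trans; [|exact Hy].
    unfold ray in Hx; unfold Rmax; destruct (Rle_dec a y); [lra|].
    rewrite !Rabs_left1; lra.
Qed.

Lemma derivable_pt_lim_Rmax_extension (u du : R -> R) :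
  derivative_on ray u du -> forall x, a < x ->
  derivable_pt_lim (fun y => u (Rmax a y)) x (du x).
Proof.
intros Hu x Hx eps Heps.
destruct (Hu x (Rlt_le _ _ Hx) eps Heps) as [delta [Hdelta Hclose]].
(* The bound [x - a] keeps [x + t] to the right of [a], where the extension agrees with [u]. *)
assert (Hmin : 0 < Rmin delta (x - a)) by (apply Rmin_pos; lra).
exists (mkposreal _ Hmin); simpl; intros t Ht0 Ht.
pose proof (Rmin_l delta (x - a)); pose proof (Rmin_r delta (x - a)).
destruct (Rabs_def2 _ _ Ht) as [_ Ht'].
rewrite !Rmax_right by lra.
specialize (Hclose (x + t)); simpl in Hclose; unfold Rdist in Hclose.
replace (x + t - x) with t in Hclose by ring.
apply Hclose; repeat split; unfold ray; lra.
Qed.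

Lemma derivative_nonneg_nondecreasing (u du : R -> R) :
  derivative_on ray u du -> (forall x, ray x -> 0 <= du x) ->
  forall x y, ray x -> x <= y -> u x <= u y.
Proof.
unfold ray; intros Hu Hpos x y Hx [Hxy| ->]; [|lra].
pose (v := fun z => u (Rmax a z)).
assert (Hder : forall c, x < c < y -> derivable_pt v c).
{ intros c Hc; exists (du c); apply derivable_pt_lim_Rmax_extension; [exact Hu|lra]. }
destruct (MVT v id x y Hder (fun c _ => derivable_pt_id c) Hxy) as [c [Hc E]].
- intros c Hc; eapply continuity_pt_Rmax_extension; [exact Hu|unfold ray; lra].
- intros c _; apply derivable_continuous_pt, derivable_pt_id.
- rewrite derive_pt_id in E.
  assert (Ed : derive_pt v c (Hder c Hc) = du c).
  { apply derive_pt_eq_0, derivable_pt_lim_Rmax_extension; [exact Hu|lra]. }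
  rewrite Ed in E; unfold v, id in E.
  rewrite !Rmax_right in E by lra.
  assert (0 <= du c) by (apply Hpos; lra).
  nra.
Qed.

Definition drop (u : R -> R) (x : R) : R := u x - u (x + 1).

Lemma derivative_on_drop (u du : R -> R) :
  derivative_on ray u du -> derivative_on ray (drop u) (drop du).
Proof.
intros Hu x Hx.
apply (Dminus ray du (fun y => du (y + 1)) u (fun y => u (y + 1))).
- exact (Hu x Hx).
(* The unit shift maps the ray into itself, so the quotients of the shifted function at [x] are
   among those of [u] at [x + 1]. *)
- assert (Hx1 : ray (x + 1)) by (unfold ray in *; lra).
  intros eps Heps.
  destruct (Hu (x + 1) Hx1 eps Heps) as [delta [Hdelta Hclose]].
  exists delta; split; [exact Hdelta|].
  intros y [[Hy Hneq] Hdist].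
  specialize (Hclose (y + 1)); simpl in *; unfold Rdist in *.
  replace (y + 1 - (x + 1)) with (y - x) in Hclose by ring.
  apply Hclose; repeat split; unfold ray in *; lra.
Qed.

Lemma nth_derivative_on_drop n (u v : R -> R) :
  nth_derivative_on ray n u v -> nth_derivative_on ray n (drop u) (drop v).
Proof.
revert v; induction n as [|n IHn]; simpl; intros v.
- intros E x Hx; unfold drop; rewrite !E; unfold ray in *; lra.
- intros [d [Hd Hv]]; exists (drop d); split.
  + exact (IHn d Hd).
  + exact (derivative_on_drop d v Hv).
Qed.

(* Unlike [completely_monotonic_on], this asks for the sign of one derivative
   of each order only, which spares proving that derivatives are unique. *)
Definition alternating_derivatives (u : R -> R) : Prop :=
  forall n, exists v, nth_derivative_on ray n u v /\
    forall x, ray x -> 0 <= (-1) ^ n * v x.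

Lemma completely_monotonic_alternating (u : R -> R) :
  completely_monotonic_on ray u -> alternating_derivatives u.
Proof.
intros [Hex Hsign] n; destruct (Hex n) as [v Hv].
exists v; split; [exact Hv|exact (Hsign n v Hv)].
Qed.

Lemma alternating_derivatives_nonneg (u : R -> R) :
  alternating_derivatives u -> forall x, ray x -> 0 <= u x.
Proof.
intros Hu x Hx; destruct (Hu O) as [v [Hv Hsign]]; simpl in *.
specialize (Hsign x Hx); rewrite (Hv x Hx) in Hsign; lra.
Qed.

(** The sign at order [n] for [drop u] comes from order [n + 1] for [u]: the latter makes
    [(-1) ^ S n * v] nondecreasing, where [v] is an [n]-th derivative of [u]. *)
Lemma alternating_derivatives_drop (u : R -> R) :
  alternating_derivatives u -> alternating_derivatives (drop u).
Proof.
intros Hu n; destruct (Hu (S n)) as [w [[v [Hv Hw]] Hsign]].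
exists (drop v); split; [exact (nth_derivative_on_drop n u v Hv)|].
intros x Hx.
assert (Hmono : (-1) ^ S n * v x <= (-1) ^ S n * v (x + 1)).
{ apply (derivative_nonneg_nondecreasing (fun y => (-1) ^ S n * v y)
           (fun y => (-1) ^ S n * w y)); [|exact Hsign|exact Hx|lra].
  intros y Hy; apply Dmult_const, Hw, Hy. }
unfold drop; simpl in Hmono; lra.
Qed.

Lemma iter_drop_alternating r (u : R -> R) :
  alternating_derivatives u -> alternating_derivatives (Nat.iter r drop u).
Proof.
intros Hu; induction r as [|r IHr]; [exact Hu|].
exact (alternating_derivatives_drop _ IHr).
Qed.

Lemma iter_drop_nth_derivative r n (u v : R -> R) :
  nth_derivative_on ray n u v ->
  nth_derivative_on ray n (Nat.iter r drop u) (Nat.iter r drop v).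
Proof.
intros Huv; induction r as [|r IHr]; [exact Huv|].
exact (nth_derivative_on_drop n _ _ IHr).
Qed.

(** Since [v] is nonnegative, the first derivative is nondecreasing, so [drop u] has a nonpositive
    derivative; comparing [drop u] at [x] and [x + 1] gives the claim. *)
Lemma second_derivative_nonneg_midpoint (u v : R -> R) :
  nth_derivative_on ray 2 u v -> (forall x, ray x -> 0 <= v x) ->
  forall x, ray x -> 2 * u (x + 1) <= u x + u (x + 2).
Proof.
(* The derivative of order zero is some [u0] that equals [u] on the ray only, so the argument runs
   on [u0] and returns to [u] at the end. *)
intros [d [[u0 [Eu Hd]] Hv]] Hpos x Hx; simpl in Eu.
assert (Hdrop : - drop u0 x <= - drop u0 (x + 1)).
{ replace (- drop u0 x) with (-1 * drop u0 x) by ring.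
  replace (- drop u0 (x + 1)) with (-1 * drop u0 (x + 1)) by ring.
  apply (derivative_nonneg_nondecreasing (fun y => -1 * drop u0 y)
           (fun y => -1 * drop d y)); [| |exact Hx|lra].
  - intros y Hy; apply Dmult_const, (derivative_on_drop u0 d Hd), Hy.
  - intros y Hy; unfold drop.
    assert (d y <= d (y + 1)); [|lra].
    apply (derivative_nonneg_nondecreasing d v); auto; lra. }
unfold drop in Hdrop.
replace (x + 1 + 1) with (x + 2) in Hdrop by ring.
rewrite !Eu in Hdrop by (unfold ray in *; lra); lra.
Qed.

End Ray.

(** A quotient of exponentials is the exponential of a forward difference, which is minus [drop];
    hence one factor [-1] per iteration. *)
Lemma iter_ratio_op_exp (f : R -> R) (m : nat) :
  (forall n, (m <= n)%nat -> 0 < f (INR n)) ->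
  forall r n, (m <= n)%nat ->
  Nat.iter r ratio_op (fun k => f (INR k)) n =
  exp ((-1) ^ r * Nat.iter r drop (fun x => ln (f x)) (INR n)).
Proof.
intros f_pos r; induction r as [|r IHr]; intros n Hn; simpl.
- rewrite Rmult_1_l, exp_ln; auto.
- unfold ratio_op at 1; unfold drop at 1.
  rewrite !IHr by lia.
  unfold Rdiv; rewrite <- exp_Ropp, <- exp_plus, plus_INR; simpl.
  f_equal; ring.
Qed.

Theorem theorem2p1 (f : R -> R) (phi : R -> R)
  (f_pos : forall x : R, 1 <= x -> 0 < f x)
  (phi_logf2 : nth_derivative_on (fun x => 1 <= x) 2 (fun x => ln (f x)) phi)
  (phi_cm : completely_monotonic_on (fun x => 1 <= x) phi) :
  infinitely_log_monotonic 1 (fun n : nat => f (INR n)).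
Proof.
intros k _ r _.
pose (h := Nat.iter r drop (fun x => ln (f x))).
assert (Hratio : forall n, (1 <= n)%nat ->
  Nat.iter r ratio_op (fun j => f (INR j)) n = exp ((-1) ^ r * h (INR n))).
{ apply iter_ratio_op_exp; intros n Hn; apply f_pos; exact (le_INR 1 n Hn). }
assert (Hconv : forall n, (2 <= n)%nat ->
  2 * h (INR n) <= h (INR (n - 1)) + h (INR (n + 1))).
{ intros n Hn.
  replace (INR n) with (INR (n - 1) + 1) by (rewrite minus_INR by lia; simpl; ring).
  replace (INR (n + 1)) with (INR (n - 1) + 2)
    by (rewrite minus_INR, plus_INR by lia; simpl; ring).
  apply (second_derivative_nonneg_midpoint 1 h (Nat.iter r drop phi)).
  - apply iter_drop_nth_derivative, phi_logf2.
  - apply alternating_derivatives_nonneg, iter_drop_alternating,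
      completely_monotonic_alternating, phi_cm.
  - apply (le_INR 1); lia. }
assert (exp_le : forall x y, x <= y -> exp x <= exp y).
{ intros x y [Hxy| ->]; [left; apply exp_increasing, Hxy|right; reflexivity]. }
(* Inside [exp], both claims compare [2 * h (INR n)] with the sum of the two neighbouring values;
   the sign [(-1) ^ r] keeps the inequality [Hconv] for even [r] and reverses it for odd [r]. *)
split.
- intros [p ->] n Hn; specialize (Hconv n ltac:(lia)).
  rewrite !Hratio by lia.
  rewrite pow_1_even; simpl pow; rewrite Rmult_1_r, <- !exp_plus; apply exp_le; lra.
- intros [p ->] n Hn; specialize (Hconv n ltac:(lia)).
  rewrite !Hratio by lia.
  rewrite Nat.add_1_r, pow_1_odd; simpl pow; rewrite Rmult_1_r, <- !exp_plus; apply exp_le.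
  rewrite Nat.add_1_r in *; lra.
Qed.
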